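(* Let $n\ge 2$. The center of $\Pi A_n$ is the cyclic group of order two generated by the automorphism $t$ of $F_n$ given by $t: x_i\mapsto x_i^{-1}$ for all $1\le i\le n$.
   Context: $F_n$ is the free group with free basis $x_1,\dots,x_n$. A palindrome is a reduced word in $x_1^{\pm1},\dots,x_n^{\pm1}$ that equals its reverse word (same letters, with their exponents, read in the opposite order). $\Pi A_n\le \mathrm{Aut}(F_n)$ is the palindromic automorphism group, consisting of all automorphisms of $F_n$ that map each $x_i$ to a palindrome. *)

(* Defs.v *)
From HB Require Import structures.
From mathcomp Require Import all_boot.
From mathcomp Require Import boolp classical_sets cardinality.

Set Implicit Arguments.
Unset Strict Implicit.
Unset Printing Implicit Defensive.

Local Open Scope group_scope.

(* The letter (i, false) is x_i and (i, true) is x_i^-1. *)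
Notation letter n := ('I_n * bool)%type.

Definition linv n (a : letter n) : letter n := (a.1, ~~ a.2).

Definition reduced n (w : seq (letter n)) : bool :=
  sorted (fun a b => b != linv a) w.

Definition push n (a : letter n) (w : seq (letter n)) : seq (letter n) :=
  if w is b :: w' then if b == linv a then w' else a :: w else [:: a].

Definition reduce n (w : seq (letter n)) : seq (letter n) :=
  foldr (@push n) [::] w.

Lemma linvK n : involutive (@linv n).
Proof. by case=> i b; rewrite /linv /= negbK. Qed.

Lemma push_reduced n (a : letter n) w : reduced w -> reduced (push a w).
Proof.
case: w => [|b w] //= pbw; case: ifPn => [_|ba]; last by rewrite /= ba.
exact: path_sorted pbw.
Qed.

Lemma reduce_reduced n (w : seq (letter n)) : reduced (reduce w).
Proof. by elim: w => //= a w; apply: push_reduced. Qed.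

Lemma reduce_id n (w : seq (letter n)) : reduced w -> reduce w = w.
Proof.
elim: w => //= a w IHw paw; rewrite IHw; last exact: path_sorted paw.
by case: w paw {IHw} => //= b w /andP[/negPf-> _].
Qed.

Lemma pushK n (a : letter n) w : reduced w -> push (linv a) (push a w) = w.
Proof.
case: w => [|b w] /=; first by rewrite linvK eqxx.
have [->|ba _] := eqVneq b (linv a); last by rewrite /= linvK eqxx.
by case: w => //= c w /andP[/negPf-> _].
Qed.

Lemma foldr_push_reduced n (w v : seq (letter n)) :
  reduced w -> reduced (foldr (@push n) w v).
Proof. by move=> rw; elim: v => //= a v; apply: push_reduced. Qed.

Lemma foldr_push n (w v : seq (letter n)) (a : letter n) : reduced w ->
  foldr (@push n) w (push a v) = push a (foldr (@push n) w v).
Proof.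
case: v => //= b v rw; have [->|//] := eqVneq b (linv a).
have := @pushK _ (linv a) _ (@foldr_push_reduced _ w v rw).
by rewrite linvK.
Qed.

Lemma foldr_reduce n (w v : seq (letter n)) : reduced w ->
  foldr (@push n) w (reduce v) = foldr (@push n) w v.
Proof. by move=> rw; elim: v => //= a v IHv; rewrite foldr_push ?IHv. Qed.

Lemma reduce_cat n (u v : seq (letter n)) :
  reduce (u ++ v) = foldr (@push n) (reduce v) u.
Proof. by rewrite /reduce foldr_cat. Qed.

Record free_group (n : nat) :=
  FreeGroup { fword : seq (letter n); fword_reduced : reduced fword }.

HB.instance Definition _ n := [isSub for @fword n].
HB.instance Definition _ n := [Choice of free_group n by <:].

Definition free_one n : free_group n := FreeGroup (isT : @reduced n [::]).

Definition free_mul n (u v : free_group n) : free_group n :=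
  FreeGroup (reduce_reduced (fword u ++ fword v)).

Lemma free_inv_reduced n (u : free_group n) :
  reduced (rev (map (@linv n) (fword u))).
Proof.
rewrite /reduced rev_sorted sorted_map; apply: sub_sorted (fword_reduced u).
by move=> a b /=; apply: contraNneq => ->; rewrite !linvK.
Qed.

Definition free_inv n (u : free_group n) : free_group n :=
  FreeGroup (free_inv_reduced u).

Lemma free_mulA n : associative (@free_mul n).
Proof.
move=> u v w; apply: val_inj => /=.
rewrite [LHS]reduce_cat [RHS]reduce_cat foldr_reduce ?reduce_reduced //.
by rewrite foldr_cat reduce_id ?reduce_reduced // reduce_cat.
Qed.

Lemma free_mul1g n : left_id (@free_one n) (@free_mul n).
Proof. by move=> u; apply: val_inj; rewrite /= reduce_id ?fword_reduced. Qed.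

Lemma free_mulg1 n : right_id (@free_one n) (@free_mul n).
Proof.
by move=> u; apply: val_inj; rewrite /= cats0 reduce_id ?fword_reduced.
Qed.

Lemma free_mulVg n : left_inverse (@free_one n) (@free_inv n) (@free_mul n).
Proof.
move=> [u ru]; apply: val_inj => /=; rewrite reduce_cat.
elim: u {ru} => //= a u IHu; rewrite rev_cons foldr_rcons pushK //.
exact: reduce_reduced.
Qed.

Lemma free_invK n : involutive (@free_inv n).
Proof.
move=> u; apply: val_inj => /=; rewrite map_rev revK -map_comp.
by rewrite (eq_map (@linvK n)) map_id.
Qed.

Lemma free_mulgV n : right_inverse (@free_one n) (@free_inv n) (@free_mul n).
Proof. by move=> u; rewrite -{1}[u]free_invK free_mulVg. Qed.

HB.instance Definition _ n := isGroup.Build (free_group n)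
  (@free_mulA n) (@free_mul1g n) (@free_mulg1 n) (@free_mulVg n) (@free_mulgV n).

Definition free_gen n (i : 'I_n) : free_group n :=
  FreeGroup (isT : reduced [:: (i, false)]).

Lemma morph_group1 (G H : groupType) (g : G -> H) :
  {morph g : u v / u * v} -> g 1 = 1.
Proof. by move=> gM; apply: (mulgI (g 1)); rewrite -gM !mulg1. Qed.

Lemma morph_groupV (G H : groupType) (g : G -> H) :
  {morph g : u v / u * v} -> {morph g : u / u^-1}.
Proof.
by move=> gM u; apply: (mulIg (g u)); rewrite -gM !mulVg morph_group1.
Qed.

(* Universal property: the homomorphism extending a map on the basis. *)
Definition free_lift n (G : groupType) (f : 'I_n -> G) (u : free_group n) : G :=
  \prod_(a <- fword u) (if a.2 then (f a.1)^-1 else f a.1).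

Lemma free_lift_gen n (G : groupType) (f : 'I_n -> G) i :
  free_lift f (free_gen i) = f i.
Proof. by rewrite /free_lift big_seq1. Qed.

Lemma free_liftM n (G : groupType) (f : 'I_n -> G) :
  {morph free_lift f : u v / u * v}.
Proof.
pose F (a : letter n) := if a.2 then (f a.1)^-1 else f a.1.
have Fpush a w : \prod_(b <- push a w) F b = F a * \prod_(b <- w) F b.
  case: w => [|b w] /=; first by rewrite big_seq1 big_nil mulg1.
  have [->|_] := eqVneq b (linv a); last by rewrite big_cons.
  rewrite big_cons mulgA; case: a => i [] /=;
  by rewrite /F /= ?mulVg ?mulgV mul1g.
move=> u v; rewrite /free_lift /= -/(F) -big_cat /=.
by elim: (fword u ++ fword v) => [|a w IHw] //=; rewrite Fpush IHw big_cons.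
Qed.

Lemma free_lift_unique n (G : groupType) (g : free_group n -> G) :
  {morph g : u v / u * v} -> g =1 free_lift (fun i => g (free_gen i)).
Proof.
move=> gM.
have g1 := morph_group1 gM; have gV := morph_groupV gM.
case=> w rw; rewrite /free_lift /=; elim: w rw => [|a w IHw] raw.
  by rewrite big_nil -g1; congr g; apply: val_inj.
have rw := path_sorted raw; rewrite big_cons -(IHw rw).
have ra : reduced [:: a] by [].
have -> : FreeGroup raw = FreeGroup ra * FreeGroup rw.
  by apply: val_inj; apply: esym; apply: (reduce_id raw).
rewrite gM; congr (_ * _); case: a ra {raw} => i [] ra /=; last first.
  by congr g; apply: val_inj.
by rewrite -gV; congr g; apply: val_inj.
Qed.

Definition is_automorphism (G : groupType) (f : G -> G) : Prop :=
  {morph f : u v / u * v} /\ bijective f.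

Record automorphism (G : groupType) := Automorphism {
  aut_fun :> G -> G;
  aut_funP : `[< is_automorphism aut_fun >]
}.

HB.instance Definition _ G := [isSub for @aut_fun G].
HB.instance Definition _ G := [Choice of automorphism G by <:].

Lemma autM (G : groupType) (f : automorphism G) : {morph f : u v / u * v}.
Proof. by case: f => f /= /asboolP[]. Qed.

Lemma aut_bij (G : groupType) (f : automorphism G) : bijective f.
Proof. by case: f => f /= /asboolP[]. Qed.

Lemma aut_eq (G : groupType) (f g : automorphism G) : f =1 g -> f = g.
Proof. by move=> /funext fg; apply: val_inj. Qed.

Lemma aut_one_proof (G : groupType) : `[< is_automorphism (@id G) >].
Proof. by apply/asboolP; split=> //; exists id. Qed.

Definition aut_one G : automorphism G := Automorphism (aut_one_proof G).

Lemma aut_mul_proof (G : groupType) (f g : automorphism G) :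
  `[< is_automorphism (f \o g) >].
Proof.
apply/asboolP; split=> [u v /=|]; first by rewrite !autM.
exact: bij_comp (aut_bij f) (aut_bij g).
Qed.

Definition aut_mul G (f g : automorphism G) : automorphism G :=
  Automorphism (aut_mul_proof f g).

Lemma aut_surj (G : groupType) (f : automorphism G) (y : G) :
  exists x, f x == y.
Proof. by case: (aut_bij f) => g _ gK; exists (g y); rewrite gK. Qed.

Definition aut_inv_fun (G : groupType) (f : automorphism G) (y : G) : G :=
  xchoose (aut_surj f y).

Lemma aut_inv_funK (G : groupType) (f : automorphism G) :
  cancel (aut_inv_fun f) f.
Proof. by move=> y; apply/eqP/(xchooseP (aut_surj f y)). Qed.

Lemma aut_funK (G : groupType) (f : automorphism G) :
  cancel f (aut_inv_fun f).
Proof. by move=> x; apply: (bij_inj (aut_bij f)); rewrite aut_inv_funK. Qed.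

Lemma aut_inv_proof (G : groupType) (f : automorphism G) :
  `[< is_automorphism (aut_inv_fun f) >].
Proof.
apply/asboolP; split; last first.
  by exists f; [exact: aut_inv_funK | exact: aut_funK].
move=> u v; apply: (bij_inj (aut_bij f)).
by rewrite autM !aut_inv_funK.
Qed.

Definition aut_inv G (f : automorphism G) : automorphism G :=
  Automorphism (aut_inv_proof f).

Lemma aut_mulA G : associative (@aut_mul G).
Proof. by move=> f g h; apply: aut_eq. Qed.

Lemma aut_mul1g G : left_id (@aut_one G) (@aut_mul G).
Proof. by move=> f; apply: aut_eq. Qed.

Lemma aut_mulg1 G : right_id (@aut_one G) (@aut_mul G).
Proof. by move=> f; apply: aut_eq. Qed.

Lemma aut_mulVg G : left_inverse (@aut_one G) (@aut_inv G) (@aut_mul G).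
Proof. by move=> f; apply: aut_eq => x /=; rewrite aut_funK. Qed.

Lemma aut_mulgV G : right_inverse (@aut_one G) (@aut_inv G) (@aut_mul G).
Proof. by move=> f; apply: aut_eq => x /=; rewrite aut_inv_funK. Qed.

HB.instance Definition _ G := isGroup.Build (automorphism G)
  (@aut_mulA G) (@aut_mul1g G) (@aut_mulg1 G) (@aut_mulVg G) (@aut_mulgV G).

Definition palindrome n (u : free_group n) : bool := rev (fword u) == fword u.

Local Open Scope classical_set_scope.

Definition palindromic_aut (n : nat) : set (automorphism (free_group n)) :=
  [set f | forall i : 'I_n, palindrome (f (free_gen i))].

Arguments palindromic_aut n : clear implicits.

Definition center_of (G : groupType) (H : set G) : set G :=
  [set x | H x /\ forall y, H y -> commute x y].

Definition cyclic_subgroup (G : groupType) (x : G) : set G :=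
  [set y | exists k : nat, y = x ^+ k \/ y = x ^- k].

Definition free_flip n : free_group n -> free_group n :=
  free_lift (fun i : 'I_n => (free_gen i)^-1).

Lemma free_flip_proof n : `[< is_automorphism (@free_flip n) >].
Proof.
have K : involutive (@free_flip n).
  have V := morph_groupV (@free_liftM n _ (fun i => (free_gen i)^-1)).
  have idE u : u = free_lift (@free_gen n) u :> free_group n.
    by rewrite -(free_lift_unique (g := id)).
  have M : {morph (fun u => free_flip (@free_flip n u)) : u v / u * v}.
    by move=> x y /=; rewrite /free_flip !free_liftM.
  move=> u; rewrite [RHS]idE (free_lift_unique M).
  congr (free_lift _ u); apply: funext => i.
  by rewrite /free_flip free_lift_gen V free_lift_gen invgK.
by apply/asboolP; split; [exact: free_liftM | exists (@free_flip n)].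
Qed.

Definition aut_t (n : nat) : automorphism (free_group n) :=
  Automorphism (free_flip_proof n).

Lemma aut_tE n (i : 'I_n) : aut_t n (free_gen i) = (free_gen i)^-1.
Proof. exact: free_lift_gen. Qed.

(* palindromic_aut is a subgroup: reversal is an anti-automorphism of the free
   group fixing the basis, and it commutes with every palindromic automorphism. *)
Lemma reduced_rev n (w : seq (letter n)) : reduced (rev w) = reduced w.
Proof.
rewrite /reduced rev_sorted; apply: eq_sorted => a b /=.
by rewrite eq_sym (can2_eq (@linvK n) (@linvK n)).
Qed.

Definition free_rev n (u : free_group n) : free_group n :=
  FreeGroup (etrans (reduced_rev (fword u)) (fword_reduced u)).

Lemma palindromeP n (u : free_group n) :
  reflect (free_rev u = u) (palindrome u).
Proof.
by apply: (iffP eqP) => [ru|/(congr1 (@fword n))]; first apply: val_inj.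
Qed.

Lemma free_revK n : involutive (@free_rev n).
Proof. by move=> u; apply: val_inj; rewrite /= revK. Qed.

Lemma free_rev_letters n (u : free_group n) :
  (free_rev u)^-1 = free_lift (fun i : 'I_n => (free_gen i)^-1) u.
Proof.
have idE v : v = free_lift (@free_gen n) v :> free_group n.
  by rewrite -(free_lift_unique (g := id)).
rewrite [LHS]idE /free_lift /= map_rev revK big_map; apply: eq_bigr.
by case=> i [] _ /=; rewrite ?invgK.
Qed.

Lemma free_revM n (u v : free_group n) :
  free_rev (u * v) = free_rev v * free_rev u.
Proof.
by apply: invg_inj; rewrite invgM !free_rev_letters free_liftM.
Qed.

Lemma free_revV n (u : free_group n) : free_rev u^-1 = (free_rev u)^-1.
Proof. by apply: val_inj; rewrite /= map_rev. Qed.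

Lemma palindromic_autP n (f : automorphism (free_group n)) :
  palindromic_aut n f <-> forall u, f (free_rev u) = free_rev (f u).
Proof.
split=> [pf u|fE i]; last first.
  by apply/palindromeP; rewrite -fE; congr (f _); apply: val_inj.
have gM : {morph (fun w => free_rev (f (free_rev w))) : x y / x * y}.
  by move=> x y /=; rewrite free_revM autM free_revM.
apply: (can_inj (@free_revK n)); rewrite free_revK.
rewrite (free_lift_unique gM) [RHS](free_lift_unique (autM f)).
congr (free_lift _ u); apply: funext => i.
have -> : free_rev (free_gen i) = free_gen i by apply: val_inj.
exact/palindromeP/pf.
Qed.

Lemma palindromic_aut1 n : palindromic_aut n (1 : automorphism (free_group n)).
Proof. by apply/palindromic_autP. Qed.

Lemma palindromic_autM n (f g : automorphism (free_group n)) :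
  palindromic_aut n f -> palindromic_aut n g -> palindromic_aut n (f * g).
Proof.
move=> /palindromic_autP fE /palindromic_autP gE; apply/palindromic_autP => u.
by rewrite /= gE fE.
Qed.

Lemma palindromic_autV n (f : automorphism (free_group n)) :
  palindromic_aut n f -> palindromic_aut n f^-1.
Proof.
move=> /palindromic_autP fE; apply/palindromic_autP => u.
by apply: (bij_inj (aut_bij f)); rewrite fE /= !aut_inv_funK.
Qed.

(* Main.v *)
Require Import Defs.
From mathcomp Require Import all_boot.
From mathcomp Require Import classical_sets cardinality.
From mathcomp Require Import perm boolp.

Local Open Scope group_scope.
Local Open Scope classical_set_scope.
Local Open Scope card_scope.

(** The automorphism [t] sends every [u] to the inverse of its reversal.
Palindromic automorphisms are exactly those that commute with reversal
([palindromic_autP]), and every automorphism commutes with inversion, so [t] is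
central.

Conversely let [f] be central.  It is enough to test [f] against two kinds of
palindromic automorphisms, both of which merely rename the letters of a reduced
word and so never create cancellation.
- The sign change of [x_j] fixes [x_i] for [i != j], hence fixes [f x_i], whose
  reduced word therefore avoids the letters of index [j]
  ([central_fword_index]).  So [f x_i] is a power of [x_i], with an exponent of
  absolute value [k], say.  The same holds for the inverse of [f], which is
  central too, with some [m] in place of [k]; composing, [k * m = 1] and
  [f x_i] is [x_i] or its inverse ([central_gen]).
- The exchange of [x_i] and [x_j] carries [f x_i] to [f x_j], so the sign is the
  same for all generators.
Hence [f] is the identity or [t].  These two differ as soon as there is a
generator. *)

(** * Automorphisms that rename letters *)

(** Requiring an involution makes the induced map its own inverse; the sign
changes and the exchanges of two generators are all of this kind. *)
Record letter_symmetry n := LetterSymmetry {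
  lsym :> letter n -> letter n;
  lsymK : involutive lsym;
  lsym_linv : {morph lsym : a / linv a}
}.

Arguments lsymK {n} l.
Arguments lsym_linv {n} l.

Lemma lsym_eq_linv {n} (s : letter_symmetry n) a b :
  (s b == linv (s a)) = (b == linv a).
Proof. by rewrite -lsym_linv (inj_eq (inv_inj (lsymK s))). Qed.

Lemma lsym_reduced {n} (s : letter_symmetry n) (u : free_group n) :
  reduced (map s (fword u)).
Proof.
rewrite /reduced sorted_map; apply: sub_sorted (fword_reduced u) => a b /=.
by rewrite lsym_eq_linv.
Qed.

Lemma map_lsym_reduce {n} (s : letter_symmetry n) w :
  map s (reduce w) = reduce (map s w).
Proof.
elim: w => //= a w <-; case: (reduce w) => //= b v.
by rewrite lsym_eq_linv; case: ifP.
Qed.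

Definition rename {n} (s : letter_symmetry n) (u : free_group n) :
  free_group n := FreeGroup (lsym_reduced s u).

Lemma rename_proof {n} (s : letter_symmetry n) :
  `[< is_automorphism (rename s) >].
Proof.
have K : involutive (rename s).
  by move=> u; apply: val_inj; rewrite /= (mapK (lsymK s)).
apply/asboolP; split; last by exists (rename s).
by move=> u v; apply: val_inj; rewrite /= map_lsym_reduce map_cat.
Qed.

Definition rename_aut {n} (s : letter_symmetry n) :
  automorphism (free_group n) := Automorphism (rename_proof s).

(** Reversal acts on positions and renaming on letters, so they commute. *)
Lemma rename_palindromic {n} (s : letter_symmetry n) :
  palindromic_aut n (rename_aut s).
Proof.
by apply/palindromic_autP => u; apply: val_inj; rewrite /= map_rev.
Qed.

Definition sign_letter {n} (j : 'I_n) (a : letter n) : letter n :=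
  (a.1, (a.1 == j) (+) a.2).

Lemma sign_letterK {n} (j : 'I_n) : involutive (sign_letter j).
Proof. by case=> i b; rewrite /sign_letter /= addbA addbb. Qed.

Lemma sign_letter_linv {n} (j : 'I_n) : {morph sign_letter j : a / linv a}.
Proof. by case=> i b; rewrite /sign_letter /linv /= addbN. Qed.

Definition sign_change {n} (j : 'I_n) : letter_symmetry n :=
  LetterSymmetry n _ (sign_letterK j) (sign_letter_linv j).

Definition swap_letter {n} (i j : 'I_n) (a : letter n) : letter n :=
  (tperm i j a.1, a.2).

Lemma swap_letterK {n} (i j : 'I_n) : involutive (swap_letter i j).
Proof. by case=> k b; rewrite /swap_letter /= tpermK. Qed.

Lemma swap_letter_linv {n} (i j : 'I_n) : {morph swap_letter i j : a / linv a}.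
Proof. by []. Qed.

Definition exchange {n} (i j : 'I_n) : letter_symmetry n :=
  LetterSymmetry n _ (swap_letterK i j) (swap_letter_linv i j).

Lemma exchange_gen {n} (i j : 'I_n) :
  rename_aut (exchange i j) (free_gen i) = free_gen j.
Proof. by apply: val_inj; rewrite /= /swap_letter tpermL. Qed.

Lemma sign_change_gen {n} (i j : 'I_n) : i != j ->
  rename_aut (sign_change j) (free_gen i) = free_gen i.
Proof. by move=> /negPf ij; apply: val_inj; rewrite /= /sign_letter /= ij. Qed.

(** * Powers of a generator *)

Lemma free_group_ext {n} (f g : automorphism (free_group n)) :
  (forall i, f (free_gen i) = g (free_gen i)) -> f = g.
Proof.
move=> fg; apply: aut_eq => u.
rewrite (free_lift_unique (autM f)) (free_lift_unique (autM g)).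
by congr (free_lift _ u); apply: funext.
Qed.

Lemma autX {G : groupType} (f : automorphism G) u k : f (u ^+ k) = f u ^+ k.
Proof.
elim: k => [|k IHk]; first by rewrite !expg0 (morph_group1 (autM f)).
by rewrite !expgS autM IHk.
Qed.

Lemma fword_genX {n} (i : 'I_n) k : fword (free_gen i ^+ k) = nseq k (i, false).
Proof.
elim: k => //= k IHk; rewrite expgS /= IHk reduce_id; last first.
  by rewrite -IHk fword_reduced.
by case: k {IHk} => //= k; rewrite /linv /= xpair_eqE andbF.
Qed.

Lemma size_fwordV {n} (u : free_group n) : size (fword u^-1) = size (fword u).
Proof. by rewrite /= size_rev size_map. Qed.

(** In a reduced word on a single generator no sign can change from one letter
to the next, since adjacent letters would cancel. *)
Lemma reduced_index_nseq {n} (i : 'I_n) w :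
  reduced w -> all (fun a : letter n => a.1 == i) w ->
  exists b, w = nseq (size w) (i, b).
Proof.
elim: w => [|[k b] w IHw] //=; first by exists false.
move=> rw /andP[/eqP ki wi]; have [c wE] := IHw (path_sorted rw) wi.
exists b; rewrite {}ki {}wE in rw * => {IHw wi}; rewrite size_nseq.
case: (size w) rw => //= m /andP[ncb _]; rewrite (_ : c = b) //.
by move: ncb; rewrite /linv /= xpair_eqE eqxx; case: b; case: c.
Qed.

Lemma index_genX {n} (i : 'I_n) (u : free_group n) :
  all (fun a : letter n => a.1 == i) (fword u) ->
  exists k, u = free_gen i ^+ k \/ u = free_gen i ^- k.
Proof.
move=> /(reduced_index_nseq i _ (fword_reduced u))[b uE].
exists (size (fword u)); case: b uE => uE; [right|left];
  apply: val_inj; rewrite [LHS]uE.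
  by rewrite [RHS]/= fword_genX map_nseq rev_nseq.
by rewrite [RHS]fword_genX.
Qed.

(** * Central palindromic automorphisms *)

(** The sign change of [x_j] moves exactly the letters of index [j], so a word
that it fixes contains none of them. *)
Lemma central_fword_index {n} (f : automorphism (free_group n)) (i : 'I_n) :
  center_of (palindromic_aut n) f ->
  all (fun a : letter n => a.1 == i) (fword (f (free_gen i))).
Proof.
case=> _ fC; apply/allP => a aw; apply: contraT => ai.
have := fC _ (rename_palindromic (sign_change a.1)).
move=> /(congr1 (fun g : automorphism _ => fword (g (free_gen i)))) /=.
rewrite -[rename _ (free_gen i)]/(rename_aut _ _) sign_change_gen 1?eq_sym //.
(* Compare the two words at a position where the letter a occurs. *)
move=> /(congr1 (nth a ^~ (index a (fword (f (free_gen i)))))) /=.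
rewrite (nth_map a) ?index_mem // nth_index // /sign_letter eqxx /=.
by case: (a) => l [].
Qed.

Lemma central_V {n} (f : automorphism (free_group n)) :
  center_of (palindromic_aut n) f -> center_of (palindromic_aut n) f^-1.
Proof.
case=> pf fC; split=> [|g pg]; first exact: palindromic_autV.
by apply/commute_sym/commuteV/commute_sym/fC.
Qed.

(** The exponents of [f] and of its inverse on [x_i] multiply to a unit; reading
them off as word lengths avoids following their signs. *)
Lemma central_gen {n} (f : automorphism (free_group n)) (i : 'I_n) :
  center_of (palindromic_aut n) f ->
  f (free_gen i) = free_gen i \/ f (free_gen i) = (free_gen i)^-1.
Proof.
move=> cf.
have [k fk] := index_genX i _ (central_fword_index f i cf).
have [m fm] := index_genX i _ (central_fword_index _ i (central_V f cf)).
have fV : f (f^-1 (free_gen i)) = free_gen i by exact: aut_inv_funK.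
have size_f l : size (fword (f (free_gen i ^+ l))) = (k * l)%N.
  by rewrite autX; case: fk => ->; rewrite ?expVgn ?size_fwordV -expgnA
       fword_genX size_nseq.
have : (k * m)%N = 1%N.
  (* Both sides of fV have the same length. *)
  have := congr1 (size \o @fword n) fV; case: fm => -> /=.
    by rewrite size_f.
  by rewrite (morph_groupV (autM f)) size_fwordV size_f.
by move=> /eqP; rewrite muln_eq1 => /andP[/eqP k1 _]; move: fk; rewrite k1.
Qed.

(** Exchanging [x_0] with [x_i] propagates the value at [x_0] to every other
generator. *)
Lemma central_cases {n} (f : automorphism (free_group n)) :
  center_of (palindromic_aut n) f -> f = 1 \/ f = aut_t n.
Proof.
move=> cf; case: n f cf => [|n] f cf.
  by left; apply: free_group_ext => -[].
have fE i : f (free_gen i) = rename_aut (exchange ord0 i) (f (free_gen ord0)).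
  rewrite -[in LHS](exchange_gen ord0 i).
  have [_ /(_ _ (rename_palindromic (exchange ord0 i)))] := cf.
  by move=> /(congr1 (fun g : automorphism _ => g (free_gen ord0))).
have [f0|f0] := central_gen f ord0 cf; [left|right];
  apply: free_group_ext => i; rewrite fE f0.
  by rewrite exchange_gen.
by rewrite (morph_groupV (autM _)) exchange_gen aut_tE.
Qed.

Lemma aut_t_rev {n} (u : free_group n) : aut_t n u = (free_rev u)^-1.
Proof. by rewrite free_rev_letters. Qed.

(** Inversion commutes with every automorphism and reversal with every
palindromic one, and [t] is their composite. *)
Lemma aut_t_central n : center_of (palindromic_aut n) (aut_t n).
Proof.
split=> [i|f /palindromic_autP fE].
  by rewrite aut_tE; apply/palindromeP; apply: val_inj.
apply: aut_eq => u; rewrite -[LHS]/(aut_t n (f u)) -[RHS]/(f (aut_t n u)).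
rewrite !aut_t_rev -fE.
by rewrite (morph_groupV (autM f)).
Qed.

Lemma center_palindromic n :
  center_of (palindromic_aut n) = [set 1; aut_t n].
Proof.
apply/seteqP; split=> [f /central_cases //|f [] -> /=].
  by split=> [|g _]; [exact: palindromic_aut1 | exact/commute_sym/commute1].
exact: aut_t_central.
Qed.

Lemma aut_t_sqr n : aut_t n * aut_t n = 1.
Proof.
apply: free_group_ext => i; rewrite -[LHS]/(aut_t n (aut_t n _)) aut_tE.
by rewrite (morph_groupV (autM _)) aut_tE invgK.
Qed.

Lemma cyclic_subgroup_involution {G : groupType} (x : G) :
  x * x = 1 -> cyclic_subgroup x = [set 1; x].
Proof.
move=> xx; have xV : x^-1 = x by apply: (mulgI x); rewrite mulgV.
have xk k : x ^+ k = 1 \/ x ^+ k = x.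
  elim: k => [|k [] IHk]; first by left.
    by right; rewrite expgS IHk mulg1.
  by left; rewrite expgS IHk.
apply/seteqP; split=> [y [k []] -> /=|y [] -> /=]; first exact: xk.
- by rewrite -expVgn xV; exact: xk.
- by exists 0%N; left.
- by exists 1%N; left.
Qed.

Lemma aut_t_neq1 n : (0 < n)%N -> aut_t n <> 1.
Proof.
case: n => // n _ /(congr1 (fun f : automorphism _ => f (free_gen ord0))).
by rewrite aut_tE => /(congr1 (@fword _)).
Qed.

Theorem theorem2p1 (n : nat) (hn : (2 <= n)%N) :
  center_of (palindromic_aut n) = cyclic_subgroup (aut_t n) /\
  (center_of (palindromic_aut n) #= `I_2).
Proof.
rewrite center_palindromic (cyclic_subgroup_involution _ (aut_t_sqr n)).
split=> //; apply/eq_cardSP; exists 1; first by left.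
rewrite setDUl setDv set0U (_ : _ `\` _ = [set aut_t n]) ?card_set1 //.
apply/seteqP; split=> [y []//|y ->]; split=> //.
by apply: aut_t_neq1; apply: ltn_trans hn.
Qed.
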